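(* Let $M$ be a smooth manifold modelled on a Banach space $\mathbb{E}$, let $k\in\mathbb{N}$, $k\ge 1$, and let $\mathcal{A}=\{(U_\alpha,\psi_\alpha)\}_{\alpha\in I}$ be a $C^\infty$ atlas of $M$. Let $\pi_k:T^kM\to M$ be the tangent bundle of order $k$, and for $\alpha\in I$ let $$\Psi_\alpha^k:\pi_k^{-1}(U_\alpha)\to\psi_\alpha(U_\alpha)\times\mathbb{E}^k,\qquad [\gamma,x_0]_k\mapsto\Big((\psi_\alpha\circ\gamma)(0),(\psi_\alpha\circ\gamma)'(0),\dots,\tfrac{1}{k!}(\psi_\alpha\circ\gamma)^{(k)}(0)\Big).$$ Then the family $\mathcal{B}=\{(\pi_k^{-1}(U_\alpha),\Psi_\alpha^k)\}_{\alpha\in I}$ defines (is an atlas of) a smooth manifold structure on $T^kM$ modelled on $\mathbb{E}^{k+1}$.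
   Context: For $x_0\in M$ let $C_{x_0}$ be the set of smooth curves $\gamma:(-\epsilon,\epsilon)\to M$ (with $\epsilon>0$ depending on $\gamma$) such that $\gamma(0)=x_0$. Two curves $\gamma_1,\gamma_2\in C_{x_0}$ are $k$-equivalent, written $\gamma_1\approx^k_{x_0}\gamma_2$, if $\gamma_1^{(j)}(0)=\gamma_2^{(j)}(0)$ for $1\le j\le k$ (derivatives computed in a chart around $x_0$; the relation does not depend on the chart). Put $T^k_{x_0}M=C_{x_0}/\approx^k_{x_0}$ and $T^kM=\bigcup_{x\in M}T^k_xM$. The class of $\gamma$ is denoted $[\gamma,x_0]_k$, and $\pi_k:T^kM\to M$ sends $[\gamma,x_0]_k$ to $x_0$. *)

(* Defs.v *)
From HB Require Import structures.
From mathcomp Require Import all_boot all_order all_algebra.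
From mathcomp Require Import all_classical all_reals all_analysis.

Set Implicit Arguments.
Unset Strict Implicit.
Unset Printing Implicit Defensive.

Import Order.TTheory GRing.Theory Num.Theory.
Import numFieldNormedType.Exports.

Local Open Scope classical_set_scope.
Local Open Scope ring_scope.

Section ContinuousLinear.
Context {R : realType} (E F : normedModType R).

Definition clin_pred : {pred (E -> F)} :=
  fun f => `[< linear f /\ continuous f >].

Record clin := CLin { clin_fun :> E -> F; _ : clin_fun \in clin_pred }.

HB.instance Definition _ := [isSub for clin_fun].
HB.instance Definition _ := [Choice of clin by <:].

Lemma clin_submod_closed : subsemimod_closed clin_pred.
Proof.
split; first split.
- apply/asboolP; split; last exact: cst_continuous.
  by move=> a u v; rewrite /GRing.zero /= scaler0 addr0.
- move=> f g /asboolP[lf cf] /asboolP[lg cg]; apply/asboolP; split.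
    move=> a u v; change (f (a *: u + v) + g (a *: u + v) =
      a *: (f u + g u) + (f v + g v)).
    by rewrite lf lg scalerDr addrACA.
  by move=> x; exact: (continuousD (cf x) (cg x)).
- move=> a f /asboolP[lf cf]; apply/asboolP; split.
    move=> b u v; change (a *: f (b *: u + v) = b *: (a *: f u) + a *: f v).
    by rewrite lf scalerDr !scalerA mulrC.
  by move=> x; exact: (continuousZl_tmp (cf x)).
Qed.

HB.instance Definition _ :=
  GRing.SubChoice_isSubLmodule.Build R (E -> F) clin_pred clin
    clin_submod_closed.

Definition opnorm (f : clin) : R := sup [set `|f x| | x in [set x | `|x| <= 1]].

Lemma clinP (f : clin) : linear f /\ continuous f.
Proof. by case: f => f /= /asboolP. Qed.

Lemma opnorm_has_sup (f : clin) :
  has_sup [set `|f x| | x in [set x | `|x| <= 1]].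
Proof.
have [lf cf] := clinP f.
split; first by exists `|f 0|, 0 => //=; rewrite normr0.
pose lfT := GRing.isLinear.Build R E F *:%R f lf.
pose g : {linear E -> F} := HB.pack (f : E -> F) lfT.
have /bounded_funP/(_ 1)[M bM] : bounded_near g (nbhs (0 : E)).
  by apply: continuous_linear_bounded; exact: cf.
by exists M => _ [x /= x1 <-]; exact: bM.
Qed.

Lemma opnorm_ub (f : clin) x : `|x| <= 1 -> `|f x| <= opnorm f.
Proof.
by move=> x1; apply: (sup_upper_bound (opnorm_has_sup f)); exists x.
Qed.

Lemma opnorm_le (f : clin) M :
  (forall x, `|x| <= 1 -> `|f x| <= M) -> opnorm f <= M.
Proof.
move=> fM; apply: ge_sup; first exact: (opnorm_has_sup f).1.
by move=> _ [x /= x1 <-]; exact: fM.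
Qed.

Lemma opnorm_ge0 (f : clin) : 0 <= opnorm f.
Proof. by rewrite (le_trans _ (@opnorm_ub f 0 _)) ?normr0. Qed.

Lemma opnormD (f g : clin) : opnorm (f + g) <= opnorm f + opnorm g.
Proof.
apply: opnorm_le => x x1; rewrite (le_trans (ler_normD (f x) (g x)))//.
by rewrite lerD// opnorm_ub.
Qed.

Lemma opnormZ_le a (f : clin) : opnorm (a *: f) <= `|a| * opnorm f.
Proof.
apply: opnorm_le => x x1; change (`|a *: f x| <= `|a| * opnorm f).
by rewrite normrZ ler_wpM2l// opnorm_ub.
Qed.

Lemma opnormZ a (f : clin) : opnorm (a *: f) = `|a| * opnorm f.
Proof.
apply/eqP; rewrite eq_le opnormZ_le/=.
have [->|a0] := eqVneq a 0; first by rewrite normr0 mul0r opnorm_ge0.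
rewrite -ler_pdivlMl ?normr_gt0// -normfV.
by rewrite (le_trans _ (opnormZ_le a^-1 _))// scalerA mulVf// scale1r.
Qed.

Lemma opnorm0_eq0 (f : clin) : opnorm f = 0 -> f = 0.
Proof.
move=> f0; apply/val_inj/funext => x.
have [lf _] := clinP f.
have fZ a y : f (a *: y) = a *: f y.
  have := lf a y 0; rewrite !addr0 => ->.
  suff -> : f 0 = 0 by rewrite addr0.
  by have := lf (-1) 0 0; rewrite scaler0 addr0 scaleN1r addNr.
have [->|x0] := eqVneq x 0; first by rewrite -(scale0r 0) [val f _]fZ scale0r.
have := @opnorm_ub f (`|x|^-1 *: x); rewrite f0 fZ !normrZ normfV normr_id.
rewrite mulVf ?normr_eq0// => /(_ (lexx _)).
by rewrite pmulr_rle0 ?invr_gt0 ?normr_gt0// normr_le0 => /eqP.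
Qed.

HB.instance Definition _ :=
  Lmodule_isNormed.Build R clin opnormD opnormZ opnorm0_eq0.

End ContinuousLinear.

Definition power {R : realType} (E : normedModType R) (n : nat) : Type :=
  {ffun 'I_n -> E}.

Section Power.
Context {R : realType}.

Section Normed.
Context (E : normedModType R) (n : nat).
Implicit Types (u v : power E n) (i : 'I_n).

HB.instance Definition _ := GRing.Lmodule.on (power E n).

Definition power_norm (v : power E n) : R := \big[Num.max/0]_i `|v i|.

Lemma power_norm_ge0 v : 0 <= power_norm v.
Proof. exact: bigmax_ge_id. Qed.

Lemma power_norm_ub v i : `|v i| <= power_norm v.
Proof. exact: le_bigmax. Qed.

Lemma power_norm_le v M :
  0 <= M -> (forall i, `|v i| <= M) -> power_norm v <= M.
Proof. by move=> M0 vM; apply: bigmax_le => // i _. Qed.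

Lemma power_normD u v : power_norm (u + v) <= power_norm u + power_norm v.
Proof.
apply: power_norm_le => [|i]; first by rewrite addr_ge0 ?power_norm_ge0.
by rewrite ffunE (le_trans (ler_normD _ _))// lerD// power_norm_ub.
Qed.

Lemma power_normZ_le a v : power_norm (a *: v) <= `|a| * power_norm v.
Proof.
apply: power_norm_le => [|i]; first by rewrite mulr_ge0 ?power_norm_ge0.
by rewrite ffunE normrZ ler_wpM2l// power_norm_ub.
Qed.

Lemma power_normZ a v : power_norm (a *: v) = `|a| * power_norm v.
Proof.
apply/eqP; rewrite eq_le power_normZ_le/=.
have [->|a0] := eqVneq a 0; first by rewrite normr0 mul0r power_norm_ge0.
rewrite -ler_pdivlMl ?normr_gt0// -normfV.
by rewrite (le_trans _ (power_normZ_le a^-1 _))// scalerA mulVf// scale1r.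
Qed.

Lemma power_norm0_eq0 v : power_norm v = 0 -> v = 0.
Proof.
move=> v0; apply/ffunP => i; rewrite ffunE; apply/eqP.
by rewrite -normr_le0 -v0 power_norm_ub.
Qed.

HB.instance Definition _ :=
  Lmodule_isNormed.Build R (power E n) power_normD power_normZ power_norm0_eq0.

End Normed.

Lemma power_complete (E : completeNormedModType R) n
    (F : set_system (power E n)) : ProperFilter F -> cauchy F -> cvg F.
Proof.
move=> FF /cauchy_ballP Fc.
have cvi (i : 'I_n) : cvg ((fun v : power E n => v i) @ F).
  apply: cauchy_cvg; apply/cauchy_ballP => e e0.
  rewrite near_map2; have := Fc e e0; apply: filterS => -[u v] /=.
  rewrite -!ball_normE /= => uv; apply: le_lt_trans uv.
  by have := power_norm_ub (u - v) i; rewrite !ffunE.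
pose l : power E n := [ffun i => lim ((fun v : power E n => v i) @ F)].
apply/cvg_ex; exists l; apply/cvgrPdist_le => e e0.
have : F [set v : power E n | forall i, `|l i - v i| <= e].
  apply: filter_forall => i; rewrite ffunE.
  by have /cvgrPdist_le/(_ e e0) := cvi i.
apply: filterS => v ve; apply: power_norm_le; first exact: ltW.
by move=> i; rewrite !ffunE; have := ve i; rewrite ffunE.
Qed.

HB.instance Definition _ (E : completeNormedModType R) n :=
  Uniform_isComplete.Build (power E n) (@power_complete E n).

End Power.

(* [is_diff] is the Frechet differential, so that [f] is [C^(n+1)] on [U] when
   it is Frechet differentiable on [U] with a differential that is [C^n] for the
   operator norm.  All uses below have an open [U]. *)
Fixpoint class_Cn {R : realType} {E : normedModType R} (n : nat)
    : forall F : normedModType R, set E -> (E -> F) -> Prop :=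
  match n with
  | 0 => fun F U f => forall x, U x -> {for x, continuous f}
  | n'.+1 => fun F U f => exists df : E -> clin E F,
      (forall x, U x -> is_diff x f (df x)) /\ class_Cn n' U df
  end.

Definition smooth_on {R : realType} {E F : normedModType R}
    (U : set E) (f : E -> F) : Prop :=
  forall n, class_Cn n U f.

(* The values of [chart_map] outside [chart_dom] are irrelevant. *)
Record chart {R : realType} (E : completeNormedModType R) (M : Type) := Chart {
  chart_dom : set M;
  chart_map :> M -> E
}.

Section Atlas.
Context {R : realType} {E : completeNormedModType R} {M : Type}.

(* [d \o c^-1], with value 0 outside the image of [chart_dom c] (an inverse
   defined on all of [E] need not exist, as [M] may be empty). *)
Definition transition (c d : chart E M) (y : E) : E :=
  if pselect (exists x, chart_dom c x /\ c x = y) is left yc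
  then d (projT1 (cid yc)) else 0.

(* A smooth atlas on a set, as in Lang's Differential and Riemannian
   Manifolds: the topology of [M] is the one for which the charts are
   homeomorphisms.  Taking [i = j] in the third field, charts have open
   images; exchanging [i] and [j] in the last one, transition maps are
   diffeomorphisms. *)
Record smooth_atlas {I : Type} (A : I -> chart E M) : Prop := SmoothAtlas {
  atlas_cover : \bigcup_i chart_dom (A i) = [set: M];
  atlas_inj : forall i, set_inj (chart_dom (A i)) (A i);
  atlas_open_overlap : forall i j,
    open (A i @` (chart_dom (A i) `&` chart_dom (A j)));
  atlas_smooth : forall i j,
    smooth_on (A i @` (chart_dom (A i) `&` chart_dom (A j)))
              (transition (A i) (A j))
}.

Context {I : Type} (A : I -> chart E M).

Definition atlas_open (O : set M) : Prop :=
  forall i, open (A i @` (chart_dom (A i) `&` O)).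

Definition atlas_hausdorff : Prop :=
  forall x y : M, x <> y -> exists O O' : set M,
    [/\ atlas_open O, atlas_open O', O x, O' y & O `&` O' = set0].

End Atlas.

Section HigherTangent.
Context {R : realType} {E : completeNormedModType R} {M : Type} {I : Type}.
Variable A : I -> chart E M.

Definition smooth_curve (D : set R) (g : R -> M) : Prop := forall i,
  open (D `&` g @^-1` chart_dom (A i)) /\
  smooth_on (D `&` g @^-1` chart_dom (A i)) (A i \o g).

(* Curves are total functions, but only their restriction to
   [`]- curve_radius, curve_radius[] matters. *)
Record curve_at (x0 : M) := CurveAt {
  curve_fun :> R -> M;
  curve_radius : R;
  curve_radius_gt0 : 0 < curve_radius;
  curve_at0 : curve_fun 0 = x0;
  curve_smooth : smooth_curve `]- curve_radius, curve_radius[ curve_fun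
}.

Definition k_equiv (k : nat) (x0 : M) (g1 g2 : curve_at x0) : Prop :=
  exists i, chart_dom (A i) x0 /\
    forall j, (1 <= j <= k)%N ->
      derive1n j (A i \o g1) 0 = derive1n j (A i \o g2) 0.

(* [k_equiv] is an equivalence only for the curves of a smooth atlas, hence
   classes are sets of curves and not elements of a quotient type. *)
Definition k_class (k : nat) (x0 : M) (g : curve_at x0) : set (curve_at x0) :=
  [set g' | k_equiv k g g'].

Definition Tk_at (k : nat) (x0 : M) : Type :=
  {c : set (curve_at x0) | exists g, c = k_class k g}.

Definition Tk (k : nat) : Type := {x : M & Tk_at k x}.

Definition jet (k : nat) (x0 : M) (g : curve_at x0) : Tk k :=
  existT (Tk_at k) x0
    (exist _ (k_class k g) (ex_intro _ g erefl)).

Definition Tk_proj (k : nat) (u : Tk k) : M := projT1 u.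

Definition Tk_repr (k : nat) (u : Tk k) : curve_at (Tk_proj u) :=
  projT1 (cid (proj2_sig (projT2 u))).

Definition taylor_coefs (k : nat) (i : I) (g : R -> M) : power E k.+1 :=
  [ffun j : 'I_k.+1 => (j`!%:R)^-1 *: derive1n j (A i \o g) 0].

Definition Tk_chart (k : nat) (i : I) : chart (power E k.+1) (Tk k) :=
  Chart (@Tk_proj k @^-1` chart_dom (A i))
        (fun u => taylor_coefs k i (Tk_repr u)).

End HigherTangent.

(* Main.v *)
Require Import Defs.
From HB Require Import structures.
From mathcomp Require Import all_boot all_order all_algebra.
From mathcomp Require Import all_classical all_reals all_analysis.

Set Implicit Arguments.
Unset Strict Implicit.
Unset Printing Implicit Defensive.

Import Order.TTheory GRing.Theory Num.Theory.
Import numFieldNormedType.Exports.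

Local Open Scope classical_set_scope.
Local Open Scope ring_scope.

(** The charts of [T^k M] read a jet through the Taylor coefficients at 0 of its
representatives, so everything reduces to one fact about a smooth map [f]
between open subsets of normed spaces: the Taylor coefficients of [f \o c] up to
order [k] are a smooth function [T] of those of [c] ([taylor_comp]).  When [f]
is the change of charts [psi_j \o psi_i^-1], this [T] is the change of charts
of [T^k M] ([taylor_coefs_transition]).

The function [T] is obtained by iterating a total derivative
([derive1n_comp_taylor]).  Suppose that the [n]-th derivative of [f \o c] is
[G (v_0, ..., v_n)], with [v_i] the [i]-th Taylor coefficient of [c].  As the
derivative of [v_i] is [(i + 1) v_(i+1)], the next derivative of [f \o c] is
[dG (v_0, ..., v_n) (v_1, 2 v_2, ..., (n + 1) v_(n+1))], again a smooth function
of the Taylor coefficients.  Keeping it smooth takes two things: that the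
differential of a smooth map is smooth for the operator norm, and that
evaluating a smooth family of linear maps at a smooth vector is smooth.  The
latter is a product rule for bounded bilinear maps ([class_Cn_bibounded]), which
gives the chain rule as well ([class_Cn_comp]).

The rest follows.  Two curves at a point are [k]-equivalent if and only if they
have the same Taylor coefficients in one chart, or in any ([k_equivP]); hence
the charts of [T^k M] are well defined and injective.  They reach every [v]
whose component [v_0] is in the image of the chart of [M], because the
polynomial curve [v_0 + t v_1 + ... + t^k v_k] has Taylor coefficients [v] and
stays in that open image for small [t] ([curve_exists]).  So domains and
overlaps become the open sets of the [v] with [v_0] in the corresponding set of
[E] ([Tk_chart_image]).  Two jets are separated by their base points or, when
these agree, by their coordinates in one chart. *)

(** * Bounded linear and bilinear maps *)

Section BoundedLinear.
Context {R : realType}.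
Implicit Types E F G V : normedModType R.

Lemma linear_bounded_clinP E F (f : E -> F) (C : R) :
  linear f -> (forall x, `|f x| <= C * `|x|) -> linear f /\ continuous f.
Proof.
move=> lf fC; split => //.
pose lfT := GRing.isLinear.Build R E F *:%R f lf.
pose g : {linear E -> F} := HB.pack (f : E -> F) lfT.
apply: (bounded_linear_continuous (f := g)).
apply/ex_bound; exists `|C|; apply/nbhs_norm0P; exists 1 => //= x /= /ltW x1.
rewrite (le_trans (fC x))// (le_trans (ler_norm _))// normrM normr_id.
by rewrite ler_piMr.
Qed.

Definition bounded_clin E F (f : E -> F) (C : R) (lf : linear f)
    (fC : forall x, `|f x| <= C * `|x|) : clin E F :=
  CLin (asboolT (linear_bounded_clinP lf fC)).

Lemma clin_linear E F (f : clin E F) : linear f.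
Proof. exact: (clinP f).1. Qed.

Lemma clin_continuous E F (f : clin E F) : continuous f.
Proof. exact: (clinP f).2. Qed.

Lemma clinD E F (f : clin E F) x y : f (x + y) = f x + f y.
Proof. by have := clin_linear f 1 x y; rewrite !scale1r. Qed.

Lemma clin0 E F (f : clin E F) : f 0 = 0.
Proof. by apply: (addrI (f 0)); rewrite -clinD !addr0. Qed.

Lemma clinZ E F (f : clin E F) a x : f (a *: x) = a *: f x.
Proof. by have := clin_linear f a x 0; rewrite clin0 !addr0. Qed.

Lemma clin_le E F (f : clin E F) x : `|f x| <= `|f| * `|x|.
Proof.
have [->|x0] := eqVneq x 0; first by rewrite clin0 !normr0 mulr0.
have xgt : 0 < `|x| by rewrite normr_gt0.
rewrite -ler_pdivrMr// mulrC.
have /(opnorm_ub f) : Num.norm (`|x|^-1 *: x) <= 1.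
  by rewrite normrZ normfV normr_id mulVf ?gt_eqF.
by rewrite clinZ normrZ normfV normr_id.
Qed.

Lemma clin_norm_le E F (f : clin E F) C : 0 <= C ->
  (forall x, `|f x| <= C * `|x|) -> `|f| <= C.
Proof.
move=> C0 fC; apply: opnorm_le => x x1.
by rewrite (le_trans (fC x))// ler_piMr.
Qed.

Lemma clin_is_diff E F (f : clin E F) x : is_diff x f f.
Proof.
pose lfT := GRing.isLinear.Build R E F *:%R f (clin_linear f).
pose g : {linear E -> F} := HB.pack (f : E -> F) lfT.
have cg : continuous g := @clin_continuous _ _ f.
split; first exact: (linear_differentiable (f := g)).
exact: (diff_lin (f := g)).
Qed.

(** Boundedness is asked through an explicit constant because the induction of
[class_Cn_bibounded] builds new bilinear maps with values in spaces [clin], for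
which a bound is easier to produce than joint continuity. *)
Record bibounded E F G (B : E -> F -> G) : Prop := BiBounded {
  bibounded_l : forall y, linear (B^~ y);
  bibounded_r : forall x, linear (B x);
  bibounded_bound : exists2 C, 0 <= C &
    forall x y, `|B x y| <= C * `|x| * `|y|
}.

Lemma bibounded_flip E F G (B : E -> F -> G) :
  bibounded B -> bibounded (fun y x => B x y).
Proof.
move=> [Bl Br [C C0 BC]]; split=> //; exists C => // y x.
by rewrite mulrAC.
Qed.

Definition bilinear_of E F G (B : E -> F -> G) (bB : bibounded B) :
    {bilinear E -> F -> G} :=
  HB.pack B (bilinear_isBilinear.Build R E F G *:%R *:%R B
    (conj (fun y => bibounded_l bB y) (fun x => bibounded_r bB x))).

(** [B p - B q = B (p_1 - q_1) q_2 + B p_1 (p_2 - q_2)], and the bounds of both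
terms tend to 0. *)
Lemma bibounded_continuous E F G (B : E -> F -> G) :
  bibounded B -> continuous (fun p : E * F => B p.1 p.2).
Proof.
move=> bB p; have [_ _ [C C0 BC]] := bB; pose f := bilinear_of bB.
apply/cvgrPdist_le => e e0.
pose r (q : E * F) := C * `|p.1 - q.1| * `|q.2| + C * `|p.1| * `|p.2 - q.2|.
have : r q @[q --> p] --> r p.
  apply: cvgD; apply: cvgM.
  - apply: cvgMr; apply: cvg_norm; apply: cvgB; [exact: cvg_cst|exact: cvg_fst].
  - apply: cvg_norm; exact: cvg_snd.
  - exact: cvg_cst.
  - apply: cvg_norm; apply: cvgB; [exact: cvg_cst|exact: cvg_snd].
rewrite {2}/r !subrr !normr0 !mulr0 mul0r addr0 => /cvgr0Pnorm_le/(_ e e0).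
apply: filterS => q; apply: le_trans; rewrite ger0_norm; last first.
  by rewrite addr_ge0// !mulr_ge0.
have -> : B p.1 p.2 - B q.1 q.2 = f (p.1 - q.1) q.2 + f p.1 (p.2 - q.2).
  by rewrite linearBl linearBr [RHS]addrC addrA subrK.
by rewrite (le_trans (ler_normD _ _))// lerD// BC.
Qed.

Lemma is_diff_bibounded V E F G (B : E -> F -> G) (a da : V -> E)
    (b db : V -> F) x : bibounded B -> is_diff x a da -> is_diff x b db ->
  is_diff x (fun y => B (a y) (b y))
            (fun h => B (da h) (b x) + B (a x) (db h)).
Proof.
move=> bB ida idb; have cB := bibounded_continuous bB.
have idp := is_diff_pair ida idb.
have idB : is_diff (a x, b x) (fun p : E * F => B p.1 p.2)
    (fun q => B (a x) q.2 + B q.1 (b x)).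
  by split; [exact: (differentiable_bilin (f := bilinear_of bB))
            |exact: (diff_bilin (f := bilinear_of bB))].
apply: (is_diff_eq (is_diff_comp idp idB)).
by apply/funext => h /=; rewrite addrC.
Qed.

Let eval_linear E F (x : E) : linear (fun f : clin E F => f x).
Proof. by []. Qed.

Let eval_le E F (x : E) (f : clin E F) : `|f x| <= `|x| * `|f|.
Proof. by rewrite mulrC clin_le. Qed.

Definition clin_eval {E F} (x : E) : clin (clin E F) F :=
  bounded_clin (@eval_linear E F x) (@eval_le E F x).

Lemma apply_bibounded E F : bibounded (fun (f : clin E F) x => f x).
Proof.
split=> [x|f|]; [exact: eval_linear|exact: clin_linear|].
by exists 1 => // f x; rewrite mul1r clin_le.
Qed.

Lemma scale_bibounded E : bibounded (fun (a : R) (x : E) => a *: x).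
Proof.
split=> [x a b c|a b x y|].
- by rewrite scalerDl -scalerA.
- by rewrite scalerDr !scalerA mulrC.
- by exists 1 => // a x; rewrite mul1r normrZ.
Qed.

End BoundedLinear.

(** * Functions of class C^n *)

Section ClassCn.
Context {R : realType}.
Implicit Types E F G V : normedModType R.

Lemma near_is_diff V E (f g df : V -> E) x :
  {near x, f =1 g} -> is_diff x f df -> is_diff x g df.
Proof.
move=> fg [dfx dfE].
have gE : g \o shift x = cst (g x) + 'd f x +o_ 0 id.
  apply/eqaddoP => e e0; have /eqaddoP/(_ e e0) := diff_locally dfx.
  have : \forall h \near (0 : V), f (h + x) = g (h + x).
    by have := fg; rewrite (near_shift 0) /= subr0.
  apply: filterS2 => h fgh.
  by rewrite /= /GRing.add /= /cst -fgh (nbhs_singleton fg).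
have dgE : 'd g x = 'd f x :> (V -> E).
  by apply: diff_unique => //; exact: diff_continuous.
split; last by rewrite dgE.
by apply/diff_locallyP; rewrite dgE; split => //; exact: diff_continuous.
Qed.

Lemma is_diff_unique V E (f df dg : V -> E) x :
  is_diff x f df -> is_diff x f dg -> df = dg.
Proof. by move=> [_ <-] [_ <-]. Qed.

Lemma is_diff_continuous V E (f df : V -> E) x :
  is_diff x f df -> {for x, continuous f}.
Proof. by move=> [dfx _]; exact: differentiable_continuous. Qed.

(** [U] is open, hence [f] and [g] have the same germ at each of its points:
agreement on [U] alone would not determine differentials.  This is what makes
derivatives, which are only known on [U], interchangeable there. *)
Lemma class_Cn_ext n V E (U : set V) (f g : V -> E) : open U ->
  {in U, f =1 g} -> class_Cn n U f -> class_Cn n U g.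
Proof.
move=> oU fg; have nfg x : U x -> {near x, f =1 g}.
  move=> Ux; have : nbhs x U by exact: open_nbhs_nbhs.
  by apply: filterS => y Uy; apply: fg; rewrite inE.
case: n => [|n] /=.
  move=> cf x Ux; have /nfg fgx := Ux.
  rewrite /prop_for /continuous_at -(nbhs_singleton fgx).
  by apply: cvg_trans (cf x Ux); exact: near_eq_cvg.
move=> [df [idf cdf]]; exists df; split => // x Ux.
by apply: near_is_diff (idf x Ux); exact: nfg.
Qed.

Lemma class_CnW n V E (U W : set V) (f : V -> E) :
  U `<=` W -> class_Cn n W f -> class_Cn n U f.
Proof.
elim: n E f => [|n IH] E f UW /=; first by move=> cf x /UW; exact: cf.
by move=> [df [idf cdf]]; exists df; split => [x /UW/idf//|]; exact: IH.
Qed.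

Lemma class_CnS n V E (U : set V) (f : V -> E) :
  class_Cn n.+1 U f -> class_Cn n U f.
Proof.
elim: n E f => [|n IH] E f [df [idf cdf]] /=.
  by move=> x /idf; exact: is_diff_continuous.
by exists df; split => //; exact: IH.
Qed.

Lemma class_Cn_cst n V E (U : set V) (e : E) : class_Cn n U (fun=> e).
Proof.
elim: n E e => [|n IH] E e /=; first by move=> x _; exact: cst_continuous.
by exists (fun=> 0); split => [x _|//]; exact: is_diff_cst.
Qed.

Lemma class_Cn_clin n V E (U : set V) (f : clin V E) : class_Cn n U f.
Proof.
case: n => [x _|n] /=; first exact: clin_continuous.
by exists (fun=> f); split => [x _|]; [exact: clin_is_diff|exact: class_Cn_cst].
Qed.

Lemma class_CnD n V E (U : set V) (f g : V -> E) :
  class_Cn n U f -> class_Cn n U g -> class_Cn n U (fun x => f x + g x).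
Proof.
elim: n E f g => [|n IH] E f g /=.
  by move=> cf cg x Ux; apply: cvgD; [exact: cf|exact: cg].
move=> [df [idf cdf]] [dg [idg cdg]]; exists (fun x => df x + dg x).
by split => [x Ux|]; [exact: (is_diffD (idf x Ux) (idg x Ux))|exact: IH].
Qed.

Lemma class_Cn_sum n V E (U : set V) m (f : 'I_m -> V -> E) :
  (forall i, class_Cn n U (f i)) -> class_Cn n U (fun x => \sum_i f i x).
Proof.
move=> cf; elim: m f cf => [|m IH] f cf.
  by under eq_fun do rewrite big_ord0; exact: class_Cn_cst.
under eq_fun do rewrite big_ord_recl.
by apply: class_CnD => //; exact: IH.
Qed.

Section Precomposition.
Context {V E F G : normedModType R} (B : E -> F -> G) (bB : bibounded B).

Let precomp_linear (a : clin V E) (y : F) : linear (fun h => B (a h) y).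
Proof. by move=> k u v; rewrite clin_linear (bibounded_l bB). Qed.

Let precomp_le (a : clin V E) (y : F) :
  exists C, forall h, `|B (a h) y| <= C * `|h|.
Proof.
have [C C0 BC] := bibounded_bound bB; exists (C * `|a| * `|y|) => h.
rewrite (le_trans (BC _ _))// [leRHS]mulrAC ler_wpM2r// -mulrA ler_wpM2l//.
exact: clin_le.
Qed.

(** In the product rule for [B (a x) (b x)], the term [h |-> B (da x h) (b x)]
is [precomp (da x) (b x)], where [precomp] is again bounded and bilinear. *)
Definition precomp (a : clin V E) (y : F) : clin V G :=
  bounded_clin (@precomp_linear a y) (projT2 (cid (precomp_le a y))).

Lemma precomp_bibounded : bibounded precomp.
Proof.
have [C C0 BC] := bibounded_bound bB; split.
- move=> y k a b; apply/val_inj/funext => h.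
  exact: (bibounded_l bB y k (a h) (b h)).
- move=> a k x y; apply/val_inj/funext => h.
  exact: (bibounded_r bB (a h) k x y).
- exists C => // a y; apply: clin_norm_le => [|h]; first by rewrite !mulr_ge0.
  rewrite (le_trans (BC _ _))// [leRHS]mulrAC ler_wpM2r// -mulrA ler_wpM2l//.
  exact: clin_le.
Qed.

End Precomposition.

(** By the product rule, the differential of [B (a x) (b x)] is a sum of two
bounded bilinear maps, [precomp] for [B] and for its flip, applied to functions
of class C^n; so the induction on [n] must range over all spaces and all [B]. *)
Lemma class_Cn_bibounded n V E F G (B : E -> F -> G) (U : set V)
    (a : V -> E) (b : V -> F) : bibounded B ->
  class_Cn n U a -> class_Cn n U b -> class_Cn n U (fun x => B (a x) (b x)).
Proof.
elim: n E F G B a b => [|n IH] E F G B a b bB /=.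
  move=> ca cb x Ux.
  apply: (@continuous2_cvg _ _ _ _ _ _ _ _ (fun u v => B u v)).
  - exact: bibounded_continuous bB (a x, b x).
  - exact: ca.
  - exact: cb.
move=> [da [ida cda]] [db [idb cdb]].
have ca : class_Cn n U a by apply: class_CnS; exists da.
have cb : class_Cn n U b by apply: class_CnS; exists db.
pose bBf := bibounded_flip bB.
exists (fun x => precomp bB (da x) (b x) + precomp bBf (db x) (a x)).
split => [x Ux|].
  exact: (is_diff_bibounded bB (ida x Ux) (idb x Ux)).
by apply: class_CnD; apply: IH => //; exact: precomp_bibounded.
Qed.

Section Compose.
Context {E F G : normedModType R}.
Implicit Types (g : clin F G) (f : clin E F).

Let clin_comp_linear g f : linear (g \o f).
Proof. by move=> a x y /=; rewrite !clin_linear. Qed.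

Let clin_comp_le g f x : `|(g \o f) x| <= `|g| * `|f| * `|x|.
Proof.
by rewrite (le_trans (clin_le g _))// -mulrA ler_wpM2l// clin_le.
Qed.

Definition clin_comp g f : clin E G :=
  bounded_clin (clin_comp_linear g f) (clin_comp_le g f).

Lemma clin_comp_bibounded : bibounded clin_comp.
Proof.
split.
- by move=> f a g g'; apply/val_inj/funext.
- by move=> g a f f'; apply/val_inj/funext => x /=; rewrite clin_linear.
- exists 1 => // g f; rewrite mul1r; apply: clin_norm_le => // x.
  exact: clin_comp_le.
Qed.

End Compose.

(** The differential of a composite is the value of the bounded bilinear map
[clin_comp] at [dg \o f], of class C^n by induction, and [df]. *)
Lemma class_Cn_comp n V E F (U : set V) (W : set E) (f : V -> E) (g : E -> F) :
  f @` U `<=` W -> class_Cn n U f -> class_Cn n W g ->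
  class_Cn n U (g \o f).
Proof.
elim: n V E F U W f g => [|n IH] V E F U W f g fUW /=.
  move=> cf cg x Ux; apply: continuous_comp; first exact: cf.
  by apply: cg; apply: fUW; exists x.
move=> [df [idf cdf]] [dg [idg cdg]].
have cf : class_Cn n U f by apply: class_CnS; exists df.
exists (fun x => clin_comp (dg (f x)) (df x)); split => [x Ux|].
  by apply: (is_diff_comp (idf x Ux)); apply: idg; apply: fUW; exists x.
apply: (class_Cn_bibounded clin_comp_bibounded) => //.
exact: (IH _ _ _ U W f dg).
Qed.

Lemma smooth_on_comp V E F (U : set V) (W : set E) (f : V -> E) (g : E -> F) :
  f @` U `<=` W -> smooth_on U f -> smooth_on W g -> smooth_on U (g \o f).
Proof. by move=> fUW sf sg n; exact: (class_Cn_comp fUW). Qed.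

Lemma smooth_on_clin_comp V E F (U : set V) (f : V -> E) (g : clin E F) :
  smooth_on U f -> smooth_on U (g \o f).
Proof.
move=> sf; apply: (smooth_on_comp (W := setT)) => // n.
exact: class_Cn_clin.
Qed.

(** [smooth_on] provides for each [n] some differential of class C^n; on an open
set they all coincide, so that a single one is of class C^n for every [n]. *)
Lemma smooth_on_diff V E (U : set V) (f : V -> E) : open U ->
  smooth_on U f -> exists df : V -> clin V E,
    (forall x, U x -> is_diff x f (df x)) /\ smooth_on U df.
Proof.
move=> oU sf; have [df [idf _]] := sf 1; exists df; split => // n.
have [dg [idg cdg]] := sf n.+1; apply: class_Cn_ext cdg => // x.
by rewrite inE => Ux; apply/val_inj/(is_diff_unique (idg x Ux) (idf x Ux)).
Qed.

Lemma smooth_on_id E (U : set E) : smooth_on U (fun x : E => x).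
Proof.
have idl : linear (fun x : E => x) by [].
have idb (x : E) : `|x| <= 1 * `|x| by rewrite mul1r.
by move=> n; exact: (class_Cn_clin n U (bounded_clin idl idb)).
Qed.

End ClassCn.

(** * Maps from and to powers of a normed space *)

Section PowerMaps.
Context {R : realType}.
Implicit Types E F V : normedModType R.

Let proj_linear E n (i : 'I_n) : linear (fun v : power E n => v i).
Proof. by move=> a u v; rewrite !ffunE. Qed.

Let proj_le E n (i : 'I_n) (v : power E n) : `|v i| <= 1 * `|v|.
Proof. by rewrite mul1r; exact: power_norm_ub. Qed.

Definition power_proj {E n} (i : 'I_n) : clin (power E n) E :=
  bounded_clin (@proj_linear E n i) (@proj_le E n i).

Let inj_linear E n (i : 'I_n) :
  linear (fun x => [ffun j => if j == i then x else 0] : power E n).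
Proof.
move=> a x y; apply/ffunP => j; rewrite !ffunE; case: eqP => // _.
by rewrite scaler0 addr0.
Qed.

Let inj_le E n (i : 'I_n) (x : E) :
  `|[ffun j => if j == i then x else 0] : power E n| <= 1 * `|x|.
Proof.
rewrite mul1r; apply: power_norm_le => // j; rewrite ffunE.
by case: eqP; rewrite ?normr0.
Qed.

Definition power_inj {E n} (i : 'I_n) : clin E (power E n) :=
  bounded_clin (@inj_linear E n i) (@inj_le E n i).

Lemma power_sum_inj E n (v : power E n) : v = \sum_i power_inj i (v i).
Proof.
apply/ffunP => j; rewrite sum_ffunE (bigD1 j)//= ffunE eqxx big1 ?addr0//.
by move=> i ij; rewrite ffunE eq_sym (negPf ij).
Qed.

Let reindex_linear E m n (s : 'I_m -> 'I_n) (c : 'I_m -> R) :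
  linear (fun v : power E n => [ffun i => c i *: v (s i)] : power E m).
Proof.
move=> a u v; apply/ffunP => i; rewrite !ffunE.
by rewrite scalerDr !scalerA mulrC.
Qed.

Let reindex_le E m n (s : 'I_m -> 'I_n) (c : 'I_m -> R) (v : power E n) :
  `|[ffun i => c i *: v (s i)] : power E m| <= (\sum_i `|c i|) * `|v|.
Proof.
have c0 (P : pred 'I_m) : 0 <= \sum_(i | P i) `|c i| by apply: sumr_ge0.
apply: power_norm_le => [|i]; first by rewrite mulr_ge0.
rewrite ffunE normrZ ler_pM//; last exact: power_norm_ub.
by rewrite (bigD1 i)//= lerDl.
Qed.

(** Covers both linear maps needed on Taylor coefficients: the truncation, and
the shift [(v_0, ..., v_(n+1)) |-> (v_1, 2 v_2, ..., (n + 1) v_(n+1))]. *)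
Definition power_reindex {E m n} (s : 'I_m -> 'I_n) (c : 'I_m -> R) :
    clin (power E n) (power E m) :=
  bounded_clin (@reindex_linear E m n s c) (@reindex_le E m n s c).

Lemma open_power_ord0 E n (U : set E) : open U ->
  open [set v : power E n.+1 | U (v ord0)].
Proof.
move=> oU; apply: (open_comp (f := power_proj ord0)) => // v _.
exact: clin_continuous.
Qed.

Lemma smooth_on_power V E (U : set V) m (f : V -> power E m) :
  (forall i, smooth_on U (fun x => f x i)) -> smooth_on U f.
Proof.
move=> sf n; have -> : f = fun x => \sum_i power_inj i (f x i).
  by apply/funext => x; exact: power_sum_inj.
apply: class_Cn_sum => i; exact: (smooth_on_clin_comp (power_inj i) (sf i)).
Qed.

End PowerMaps.

(** * Taylor coefficients of a composite *)

Section TaylorCoefficients.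
Context {R : realType}.
Implicit Types E F : normedModType R.

Lemma derive1_is_diff E (f df : R -> E) t :
  is_diff t f df -> derive1 f t = df 1.
Proof. by move=> [d <-]; rewrite derive1E'. Qed.

Lemma near_eq_derive1n E (f g : R -> E) n (t : R) :
  {near t, f =1 g} -> {near t, derive1n n f =1 derive1n n g}.
Proof.
elim: n => [//|n IH] /IH fg; rewrite !derive1nS.
apply: filterS (near_join fg) => s fgs.
by rewrite !derive1E; exact: near_eq_derive.
Qed.

(** The derivative of a curve is its differential evaluated at 1, and evaluation
is a continuous linear map. *)
Lemma smooth_on_derive1n E (J : set R) (c : R -> E) n : open J ->
  smooth_on J c -> smooth_on J (derive1n n c).
Proof.
move=> oJ sc; elim: n => [//|n IH]; rewrite derive1nS.
have [dc [idc sdc]] := smooth_on_diff oJ IH.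
have sdc1 := smooth_on_clin_comp (clin_eval (F := E) (1 : R)) sdc.
move=> m; apply: class_Cn_ext (sdc1 m) => // t.
by rewrite inE => Jt; rewrite (derive1_is_diff (idc t Jt)).
Qed.

Lemma derive1_clin E F (f : R -> E) (L : clin E F) t :
  differentiable f t -> derive1 (L \o f) t = L (derive1 f t).
Proof.
move=> /differentiableP df.
have := is_diff_comp df (clin_is_diff L (f t)).
by move=> /derive1_is_diff ->; rewrite (derive1_is_diff df).
Qed.

Definition taylor E n (c : R -> E) (t : R) : power E n.+1 :=
  [ffun i : 'I_n.+1 => (i`!%:R)^-1 *: derive1n i c t].

Lemma taylor_ord0 E n (c : R -> E) t : taylor n c t ord0 = c t.
Proof. by rewrite ffunE fact0 invr1 scale1r. Qed.

Lemma near_eq_taylor E n (c d : R -> E) (t : R) :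
  {near t, c =1 d} -> taylor n c t = taylor n d t.
Proof.
move=> cd; apply/ffunP => i; rewrite !ffunE.
by rewrite (nbhs_singleton (near_eq_derive1n i cd)).
Qed.

Lemma smooth_on_taylor E n (J : set R) (c : R -> E) :
  open J -> smooth_on J c -> smooth_on J (taylor n c).
Proof.
move=> oJ sc; apply: smooth_on_power => i.
under eq_fun do rewrite ffunE.
move=> m; apply: (class_Cn_bibounded (scale_bibounded E)).
  exact: class_Cn_cst.
exact: (smooth_on_derive1n i oJ sc m).
Qed.

(** The coefficient [i + 1] appears since [c^(i+1) / i!] is [i + 1] times
[c^(i+1) / (i + 1)!]. *)
Lemma derive1_taylor E n (J : set R) (c : R -> E) t :
  open J -> smooth_on J c -> J t ->
  derive1 (taylor n c) t =
    power_reindex (lift ord0) (fun i : 'I_n.+1 => i.+1%:R) (taylor n.+1 c t).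
Proof.
move=> oJ sc Jt.
have [d [id _]] := smooth_on_diff oJ (smooth_on_taylor n oJ sc).
have dt : differentiable (taylor n c) t by case: (id t Jt).
apply/ffunP => i; rewrite -[LHS](derive1_clin (power_proj i) dt).
have [dc [idc _]] := smooth_on_diff oJ (smooth_on_derive1n i oJ sc).
have -> : power_proj i \o taylor n c = (i`!%:R)^-1 \*: derive1n i c.
  by apply/funext => s /=; rewrite ffunE.
rewrite (derive1_is_diff (is_diffZ _ (idc t Jt))).
rewrite !ffunE lift0 derive1nS (derive1_is_diff (idc t Jt)).
by rewrite scalerA factS natrM invfM mulrA divff ?mul1r.
Qed.

Lemma taylor_trunc E m n (mn : (m < n.+1)%N) (c : R -> E) t :
  power_reindex (widen_ord mn) (fun=> 1) (taylor n c t) = taylor m c t.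
Proof. by apply/ffunP => i; rewrite !ffunE scale1r. Qed.

(** A smooth form of Faa di Bruno's formula without its combinatorics: the
polynomial in the derivatives of [f] and [c] is replaced by a recursively
defined [G_n], where [G_(n+1) v] is the differential of [G_n] at
[(v_0, ..., v_n)] in the direction [(v_1, 2 v_2, ..., (n + 1) v_(n+1))].  Since
[G_n] depends on [f] only, curves with the same Taylor coefficients have images
with the same derivatives. *)
Lemma derive1n_comp_taylor E F (U : set E) (f : E -> F) : open U ->
  smooth_on U f -> forall n, exists G : power E n.+1 -> F,
    smooth_on [set v : power E n.+1 | U (v ord0)] G /\
    forall (J : set R) (c : R -> E), open J -> smooth_on J c ->
      (forall t, J t -> U (c t)) ->
      forall t, J t -> derive1n n (f \o c) t = G (taylor n c t).
Proof.
move=> oU sf; elim=> [|n [G [sG GE]]].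
  exists (f \o power_proj ord0); split.
    apply: (smooth_on_comp (W := U)) => //; first by move=> _ [v Uv <-].
    by move=> n; exact: class_Cn_clin.
  by move=> J c oJ sc JU t Jt; rewrite /= taylor_ord0.
have oUn : open [set v : power E n.+1 | U (v ord0)] by exact: open_power_ord0.
have [dG [idG sdG]] := smooth_on_diff oUn sG.
(* [P] truncates and [S] shifts, so that [P (taylor n.+1 c t) = taylor n c t]
   while [S (taylor n.+1 c t)] is the derivative of [taylor n c] at [t]. *)
pose P := power_reindex (E := E) (widen_ord (leqnSn n.+1)) (fun=> 1).
pose S := power_reindex (E := E) (lift ord0) (fun i : 'I_n.+1 => i.+1%:R).
exists (fun v => dG (P v) (S v)); split.
  move=> m; apply: (class_Cn_bibounded (apply_bibounded _ _)).
    apply: (class_Cn_comp (f := P) (g := dG)); last exact: sdG.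
      move=> _ [v Uv <-] /=; rewrite ffunE scale1r.
      by rewrite (_ : widen_ord _ _ = ord0)//; exact: val_inj.
    exact: class_Cn_clin.
  exact: class_Cn_clin.
move=> J c oJ sc JU t Jt.
rewrite derive1nS.
have nE : {near t, derive1n n (f \o c) =1 G \o taylor n c}.
  have : nbhs t J by exact: open_nbhs_nbhs.
  by apply: filterS => s; exact: (GE J c oJ sc JU).
rewrite derive1E (near_eq_derive _ nE) -derive1E.
have [dT [idT _]] := smooth_on_diff oJ (smooth_on_taylor n oJ sc).
have UT : U (taylor n c t ord0) by rewrite taylor_ord0; exact: JU.
rewrite (derive1_is_diff (is_diff_comp (idT t Jt) (idG _ UT))) /=.
rewrite -(derive1_is_diff (idT t Jt)) (derive1_taylor n oJ)//.
by congr (dG _ _); rewrite -(taylor_trunc (leqnSn n.+1)).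
Qed.

Lemma taylor_comp E F (U : set E) (f : E -> F) n : open U -> smooth_on U f ->
  exists T : power E n.+1 -> power F n.+1,
    smooth_on [set v : power E n.+1 | U (v ord0)] T /\
    forall (J : set R) (c : R -> E), open J -> smooth_on J c ->
      (forall t, J t -> U (c t)) ->
      forall t, J t -> taylor n (f \o c) t = T (taylor n c t).
Proof.
move=> oU sf.
have /choice[G GP] : forall i : 'I_n.+1, exists G : power E n.+1 -> F,
    smooth_on [set v : power E n.+1 | U (v ord0)] G /\
    forall (J : set R) (c : R -> E), open J -> smooth_on J c ->
      (forall t, J t -> U (c t)) ->
      forall t, J t -> derive1n i (f \o c) t = G (taylor n c t).
  move=> i; have [G [sG GE]] := derive1n_comp_taylor oU sf i.
  pose P := power_reindex (E := E) (widen_ord (ltn_ord i)) (fun=> 1).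
  exists (G \o P); split.
    apply: smooth_on_comp sG => [_ [v Uv <-] /=|m].
      rewrite ffunE scale1r (_ : widen_ord _ _ = ord0)//; exact: val_inj.
    exact: class_Cn_clin.
  move=> J c oJ sc cU t Jt; rewrite (GE J)//; congr (G _).
  by rewrite -(taylor_trunc (ltn_ord i)).
exists (fun v => [ffun i : 'I_n.+1 => (i`!%:R)^-1 *: G i v]); split.
  apply: smooth_on_power => i m /=.
  rewrite (_ : (fun v => _) = fun v => (i`!%:R)^-1 *: G i v); last first.
    by apply/funext => v; rewrite ffunE.
  apply: (class_Cn_bibounded (scale_bibounded F)); first exact: class_Cn_cst.
  exact: (GP i).1.
move=> J c oJ sc cU t Jt; apply/ffunP => i; rewrite !ffunE.
by rewrite ((GP i).2 J).
Qed.

End TaylorCoefficients.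

(** * Polynomial curves *)

Section PolynomialCurve.
Context {R : realType}.
Implicit Types E F : normedModType R.

Definition poly_curve E n (v : power E n) (t : R) : E :=
  \sum_(i < n) t ^+ i *: v i.

Lemma smooth_on_poly_curve E n (J : set R) (v : power E n) :
  smooth_on J (poly_curve v).
Proof.
move=> m; apply: class_Cn_sum => i.
apply: (class_Cn_bibounded (scale_bibounded E)); last exact: class_Cn_cst.
elim: (i : nat) => [|k IH]; first exact: class_Cn_cst.
under eq_fun do rewrite exprS.
exact: (class_Cn_bibounded (scale_bibounded R)) (smooth_on_id _ m) IH.
Qed.

Lemma poly_curve_continuous E n (v : power E n) : continuous (poly_curve v).
Proof. by move=> t; exact: (smooth_on_poly_curve setT v 0). Qed.

Lemma is_derive_monomial E (a : R) k (w : E) (t : R) :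
  is_derive t 1 (fun s : R => (a * s ^+ k) *: w)
    ((a * (k%:R * t ^+ k.-1)) *: w).
Proof.
have dk : differentiable (fun s : R => s ^+ k) t.
  by apply/derivable1_diffP; exact: exprn_derivable.
have -> : (fun s : R => (a * s ^+ k) *: w) = (fun s : R => s ^+ k *: (a *: w)).
  by apply/funext => s; rewrite scalerA mulrC.
have d := differentiableZl (a *: w) dk.
apply: DeriveDef; first exact: diff_derivable.
rewrite deriveE// diffZl// -deriveE// exp_derive.
by rewrite scalerA /GRing.scale /= mulr1 [in RHS]mulrC.
Qed.

Lemma derive1n_poly_curve E n (v : power E n) m :
  derive1n m (poly_curve v) =
  (fun t => \sum_(i < n) ((i ^_ m)%:R * t ^+ (i - m)) *: v i).
Proof.
elim: m => [|m IH].
  by apply/funext => t; apply: eq_bigr => i _; rewrite ffactn0 mul1r subn0.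
rewrite derive1nS IH; apply/funext => t; rewrite derive1E.
have := is_derive_sum (fun i : 'I_n =>
  is_derive_monomial (i ^_ m)%:R (i - m) (v i) t).
rewrite (_ : \sum_(i < n) _ =
  (fun s : R => \sum_(i < n) ((i ^_ m)%:R * s ^+ (i - m)) *: v i)); last first.
  by apply/funext => s; rewrite fct_sumE.
move=> [_ ->]; apply: eq_bigr => i _.
by rewrite mulrA -natrM -ffactnSr subnS.
Qed.

Lemma poly_curve0 E n (v : power E n.+1) : poly_curve v 0 = v ord0.
Proof.
rewrite /poly_curve big_ord_recl expr0 scale1r big1 ?addr0// => i _.
by rewrite expr0n scale0r.
Qed.

Lemma taylor_poly_curve E n (v : power E n.+1) : taylor n (poly_curve v) 0 = v.
Proof.
apply/ffunP => i; rewrite ffunE derive1n_poly_curve (bigD1 i)//=.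
rewrite subnn expr0 mulr1 ffactnn big1 ?addr0.
  by rewrite scalerA mulVf ?scale1r// pnatr_eq0 -lt0n fact_gt0.
move=> j ji; have [jlt|ijlt|/val_inj ij] := ltngtP j i.
- by rewrite ffact_small// mul0r scale0r.
- by rewrite expr0n subn_eq0 leqNgt ijlt mulr0 scale0r.
- by rewrite ij eqxx in ji.
Qed.

End PolynomialCurve.

(** * Charts of the tangent bundle of order k *)

Lemma open_setI_preimage (V W : topologicalType) (f : V -> W) U B :
  open U -> (forall x, U x -> {for x, continuous f}) -> open B ->
  open (U `&` f @^-1` B).
Proof.
move=> oU cf oB; rewrite openE => x [Ux Bfx].
apply: filterI; first exact: open_nbhs_nbhs.
by apply: (cf x Ux); exact: open_nbhs_nbhs.
Qed.

Lemma transitionE {R : realType} {E : completeNormedModType R} {M : Type}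
    (c d : chart E M) x :
  set_inj (chart_dom c) c -> chart_dom c x -> transition c d (c x) = d x.
Proof.
move=> injc cx; rewrite /transition; case: pselect => [y|[]]; last by exists x.
by case: cid => z /= [cz zE]; rewrite (injc z x) ?inE.
Qed.

Section Charts.
Context {R : realType} {E : completeNormedModType R} {M I : Type}.
Context (A : I -> chart E M) (HA : smooth_atlas A).

Local Notation dom i := (chart_dom (A i)).
Local Notation overlap i j := (A i @` (dom i `&` dom j)).

Let transition_atlas i j x :
  dom i x -> transition (A i) (A j) (A i x) = A j x.
Proof. by apply: transitionE; exact: atlas_inj. Qed.

Lemma chart_exists x : exists i, dom i x.
Proof.
have : [set: M] x by [].
by rewrite -(atlas_cover HA) => -[i _ ix]; exists i.
Qed.

(** Seen in the chart [j], this set is the preimage of [B] by the transition map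
from [j] to [i], which is continuous on an open set. *)
Lemma atlas_open_chart_preimage i (B : set E) : open B ->
  atlas_open A (dom i `&` A i @^-1` B).
Proof.
move=> oB j.
have -> : A j @` (dom j `&` (dom i `&` A i @^-1` B)) =
    overlap j i `&` transition (A j) (A i) @^-1` B.
  apply/seteqP; split=> [_ [x [jx [ix Bx]] <-]|_ [[x [jx ix] <-]]].
    by split; [exists x|rewrite /preimage /= transition_atlas].
  by rewrite /preimage /= transition_atlas// => Bx; exists x.
apply: open_setI_preimage oB; first exact: (atlas_open_overlap HA).
exact: (atlas_smooth HA j i 0).
Qed.

Section Curves.
Context {x0 : M}.
Implicit Types g : curve_at A x0.

Lemma taylor_coefs_ord0 k i g : taylor_coefs A k i g ord0 = A i x0.
Proof. by rewrite [LHS](taylor_ord0 k (A i \o g) 0) /= curve_at0. Qed.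

Lemma curve_in_chart i g : dom i x0 -> exists J : set R,
  [/\ open J, J 0, J `<=` g @^-1` dom i & smooth_on J (A i \o g)].
Proof.
move=> ix; have [oJ sJ] := curve_smooth g i.
exists (`]- curve_radius g, curve_radius g[ `&` g @^-1` dom i).
split=> //; split; last by rewrite /preimage /= curve_at0.
by rewrite /= in_itv /= oppr_lt0 curve_radius_gt0.
Qed.

(** The orders [j >= 1] suffice because the coefficient of order 0 is the base
point in the chart [i], the same for both curves. *)
Lemma taylor_coefs_eqP k i g1 g2 :
  taylor_coefs A k i g1 = taylor_coefs A k i g2 <->
  (forall j, (1 <= j <= k)%N ->
    derive1n j (A i \o g1) 0 = derive1n j (A i \o g2) 0).
Proof.
split=> [/ffunP e j /andP[_ jk]|e].
  have := e (Ordinal (jk : (j < k.+1)%N)); rewrite !ffunE /= => /scalerI; apply.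
  by rewrite invr_eq0 pnatr_eq0 -lt0n fact_gt0.
apply/ffunP => j; rewrite !ffunE; congr (_ *: _).
case: (posnP j) => [->|j0]; first by rewrite /= !curve_at0.
by apply: e; rewrite j0 -ltnS ltn_ord.
Qed.

End Curves.

(** Near 0 a curve in the chart [j] is the composite of the transition map with
the same curve in the chart [i], so that [taylor_comp] applies.  The same [T]
serves all base points and all curves: it is the change of charts of [T^k M]. *)
Lemma taylor_coefs_transition k i j :
  exists T : power E k.+1 -> power E k.+1,
    smooth_on [set v : power E k.+1 | overlap i j (v ord0)] T /\
    forall x0 (g : curve_at A x0), dom i x0 -> dom j x0 ->
      taylor_coefs A k j g = T (taylor_coefs A k i g).
Proof.
have [T [sT TE]] :=
  taylor_comp k (atlas_open_overlap HA i j) (atlas_smooth HA i j).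
exists T; split=> // x0 g ix jx.
have [Ji [oJi Ji0 Jig sJi]] := curve_in_chart g ix.
have [Jj [oJj Jj0 Jjg _]] := curve_in_chart g jx.
rewrite -[RHS](TE (Ji `&` Jj)).
- apply: near_eq_taylor.
  have : nbhs (0 : R) Ji by exact: open_nbhs_nbhs.
  by apply: filterS => t /Jig/= ?; rewrite transition_atlas.
- exact: openI.
- by move=> n; exact: class_CnW (sJi n).
- by move=> t [/Jig ? /Jjg ?]; exists (g t).
- by [].
Qed.

(** [k_equiv] compares derivatives in one unspecified chart; the transition
functions [T] carry the equality to the chart [i].  This also yields that
[k_equiv] is an equivalence relation. *)
Lemma k_equivP k i x0 (g1 g2 : curve_at A x0) : dom i x0 ->
  k_equiv k g1 g2 <-> taylor_coefs A k i g1 = taylor_coefs A k i g2.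
Proof.
move=> ix; split=> [[j [jx /taylor_coefs_eqP e]]|e]; last first.
  by exists i; split=> //; exact/taylor_coefs_eqP.
have [T [_ TE]] := taylor_coefs_transition k j i.
by rewrite !TE// e.
Qed.

Lemma jet_eq k i x1 x2 (g1 : curve_at A x1) (g2 : curve_at A x2) :
  dom i x1 -> dom i x2 ->
  taylor_coefs A k i g1 = taylor_coefs A k i g2 -> jet k g1 = jet k g2.
Proof.
move=> ix1 ix2 e.
have x12 : x1 = x2.
  apply: (atlas_inj HA (i := i)); rewrite ?inE//.
  by rewrite -(taylor_coefs_ord0 k i g1) e taylor_coefs_ord0.
move: g2 e; rewrite -x12 => g2 e; congr (existT _ _ _).
apply: eq_sig_hprop => [? ? ?|/=]; first exact: Prop_irrelevance.
apply/seteqP; split=> g; rewrite /k_class /= => /(k_equivP _ _ _ ix1) eg;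
  apply/(k_equivP _ _ _ ix1); first by rewrite -e.
by rewrite e.
Qed.

Lemma jet_repr k (u : Tk A k) : u = jet k (Tk_repr u).
Proof.
case: u => x [c cP]; congr (existT _ _ _).
apply: eq_sig_hprop => [? ? ?|/=]; first exact: Prop_irrelevance.
exact: projT2 (cid cP).
Qed.

Lemma Tk_chart_jet k i x0 (g : curve_at A x0) : dom i x0 ->
  Tk_chart A k i (jet k g) = taylor_coefs A k i g.
Proof.
move=> ix; apply/esym/(k_equivP _ _ _ ix).
have : k_class k g = k_class k (Tk_repr (jet k g)).
  exact: projT2 (cid (proj2_sig (projT2 (jet k g)))).
have : k_class k (Tk_repr (jet k g)) (Tk_repr (jet k g)).
  exact/(k_equivP _ _ _ ix).
by move=> + e; rewrite -e.
Qed.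

(** Lift to [M] the polynomial curve with coefficients [v], which stays in the
open image of the chart [i] on a small interval. *)
Lemma curve_exists k i x0 (v : power E k.+1) : dom i x0 ->
  v ord0 = A i x0 -> exists g : curve_at A x0, taylor_coefs A k i g = v.
Proof.
move=> ix v0; pose p := poly_curve v.
have p0 : p 0 = A i x0 by rewrite /p poly_curve0.
have oU : open (A i @` dom i).
  by have := atlas_open_overlap HA i i; rewrite setIid.
have : nbhs (p 0) (A i @` dom i).
  by rewrite p0; apply: open_nbhs_nbhs; split=> //; exists x0.
move=> /poly_curve_continuous/nbhs_ballP[e /= e0 pe].
(* The default [x0] is taken only where [p t] leaves the image of the chart. *)
pose g t := if pselect (exists x, dom i x /\ A i x = p t) is left y
  then projT1 (cid y) else x0.
have gp t : `]- e, e[%classic t -> dom i (g t) /\ A i (g t) = p t.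
  rewrite /= in_itv /= -ltr_norml => te.
  have [|x ix' xp] := pe t; first by rewrite -ball_normE /= sub0r normrN.
  rewrite /g; case: pselect => [y|[]]; last by exists x.
  by case: cid.
have D0 : `]- e, e[%classic (0 : R) by rewrite /= in_itv /= oppr_lt0 e0.
have [ig0 g0] := gp 0 D0.
have gx0 : g 0 = x0.
  by apply: (atlas_inj HA (i := i)); rewrite ?inE// g0.
have gs : smooth_curve A `]- e, e[ g.
  move=> j.
  have DE : `]- e, e[ `&` g @^-1` dom j = `]- e, e[ `&` p @^-1` overlap i j.
    apply/seteqP; split=> t [Dt]; rewrite /preimage /=;
      have [igt gt] := gp t Dt.
      by move=> jgt; split=> //; exists (g t).
    move=> [x [ix' jx] xp]; split=> //.
    by rewrite (atlas_inj HA (i := i) (x := g t) (y := x)) ?inE// gt.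
  have oD : open (`]- e, e[ `&` g @^-1` dom j).
    rewrite DE; apply: open_setI_preimage (atlas_open_overlap HA i j).
      exact: interval_open.
    by move=> t _; exact: poly_curve_continuous.
  split=> // n.
  apply: (@class_Cn_ext _ _ _ _ _ (transition (A i) (A j) \o p)) => //.
    move=> t; rewrite inE => -[Dt _]; have [igt gt] := gp t Dt.
    by rewrite /= -gt transition_atlas.
  apply: (class_Cn_comp (W := overlap i j)).
  - by move=> _ [t] + <-; rewrite DE => -[].
  - exact: smooth_on_poly_curve.
  - exact: (atlas_smooth HA i j).
exists (CurveAt e0 gx0 gs).
rewrite -[RHS](taylor_poly_curve v); apply: near_eq_taylor.
have : nbhs (0 : R) `]- e, e[%classic.
  by apply: open_nbhs_nbhs; split=> //; exact: interval_open.
by apply: filterS => t /gp[].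
Qed.

(** With [S := setT] this is the image of a chart, with [S := dom j] an overlap,
and with [S] open in [M] it says that the preimage of [S] by the projection is
open. *)
Lemma Tk_chart_image k i (S : set M) :
  Tk_chart A k i @` (@Tk_proj _ _ _ _ A k @^-1` (dom i `&` S)) =
  [set v : power E k.+1 | (A i @` (dom i `&` S)) (v ord0)].
Proof.
apply/seteqP; split=> [_ [u [iu Su] <-] /=|v [x [ix Sx] xv]].
  by rewrite taylor_coefs_ord0; exists (Tk_proj u).
have [g gv] := curve_exists ix (esym xv).
by exists (jet k g); [split|rewrite Tk_chart_jet].
Qed.

Lemma Tk_smooth_atlas k : smooth_atlas (Tk_chart A k).
Proof.
have overlapE i j : Tk_chart A k i @`
      (chart_dom (Tk_chart A k i) `&` chart_dom (Tk_chart A k j)) =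
    [set v : power E k.+1 | overlap i j (v ord0)].
  exact: Tk_chart_image.
have inj i : set_inj (chart_dom (Tk_chart A k i)) (Tk_chart A k i).
  move=> u w; rewrite !inE => iu iw e.
  by rewrite (jet_repr u) (jet_repr w); exact: jet_eq e.
split=> // [|i j|i j].
- apply/seteqP; split=> // u _.
  by have [i iu] := chart_exists (Tk_proj u); exists i.
- by rewrite overlapE; apply: open_power_ord0; exact: atlas_open_overlap.
- have [T [sT TE]] := taylor_coefs_transition k i j.
  move=> n; rewrite overlapE; apply: class_Cn_ext (sT n).
    by apply: open_power_ord0; exact: atlas_open_overlap.
  move=> v; rewrite inE -overlapE => -[u [iu ju] <-].
  by rewrite (transitionE _ (inj i) iu) -(TE _ (Tk_repr u)).
Qed.

End Charts.

(** Jets over distinct points are separated by preimages of open sets of [M];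
jets over the same point have a common chart of [T^k M], in which preimages of
open sets of the Hausdorff space [E^(k+1)] separate them. *)
Lemma Tk_hausdorff {R : realType} {E : completeNormedModType R} {M I : Type}
    (A : I -> chart E M) k :
  smooth_atlas A -> atlas_hausdorff A -> atlas_hausdorff (Tk_chart A k).
Proof.
move=> HA AH u w uw; have HT := Tk_smooth_atlas HA k.
have [e|/AH[S [S' [oS oS' Su S'w SS']]]] := pselect (Tk_proj u = Tk_proj w).
  have [i iu] := chart_exists HA (Tk_proj u).
  have iw : chart_dom (A i) (Tk_proj w) by rewrite -e.
  have cuw : Tk_chart A k i u != Tk_chart A k i w.
    by apply/eqP => /(atlas_inj HT); rewrite !inE => /(_ iu iw).
  have := @norm_hausdorff _ (power E k.+1); rewrite open_hausdorff.
  move=> /(_ _ _ cuw)[[B B'] /= [uB wB] [oB oB' /eqP BB']].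
  move: uB wB; rewrite !inE => uB wB.
  exists (chart_dom (Tk_chart A k i) `&` Tk_chart A k i @^-1` B),
    (chart_dom (Tk_chart A k i) `&` Tk_chart A k i @^-1` B').
  split=> //; try exact: atlas_open_chart_preimage.
  by rewrite setIACA -preimage_setI BB' preimage_set0 setI0.
have oT (O : set M) : atlas_open A O ->
    atlas_open (Tk_chart A k) (@Tk_proj _ _ _ _ A k @^-1` O).
  move=> oO i; have := Tk_chart_image HA k i O.
  by rewrite preimage_setI => ->; apply: open_power_ord0.
exists (@Tk_proj _ _ _ _ A k @^-1` S), (@Tk_proj _ _ _ _ A k @^-1` S').
split=> //; try exact: oT.
by rewrite -preimage_setI SS' preimage_set0.
Qed.

Theorem theorem2p1 (R : realType) (E : completeNormedModType R) (M : Type)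
    (I : Type) (A : I -> chart E M) (k : nat) :
  (1 <= k)%N ->
  smooth_atlas A ->
  [/\ (* the charts are well defined: they do not depend on representatives *)
      forall i (x0 : M) (g : curve_at A x0), chart_dom (A i) x0 ->
        Tk_chart A k i (jet k g) = taylor_coefs A k i g,
      (* they map the preimage of U_i onto psi_i(U_i) x E^k *)
      forall i, Tk_chart A k i @` chart_dom (Tk_chart A k i) =
        [set v : power E k.+1 | (A i @` chart_dom (A i)) (v ord0)],
      (* they form a smooth atlas modelled on E^(k+1) *)
      smooth_atlas (Tk_chart A k)
      (* and the Hausdorff property is inherited, for readers who include it
         in the definition of a manifold *)
    & atlas_hausdorff A -> atlas_hausdorff (Tk_chart A k)].
Proof.
move=> _ HA; split.
- by move=> i x0 g; exact: Tk_chart_jet.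
- by move=> i; have := Tk_chart_image HA k i setT; rewrite setIT.
- exact: Tk_smooth_atlas.
- exact: Tk_hausdorff.
Qed.
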